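(* For every perfect matching $M_0$ of $G^+$, the map $\Psi_{M_0}:M(G^+)\to K(G^+)$ is a bijection (and $\Psi_{M_0}(M_0)=0$).
   Context: $G$ is a finite connected planar graph (multi-edges allowed, no loops) with a fixed embedding in the plane, and $q$ is a fixed vertex of $G$ lying on the boundary of the infinite (outer) face. Let $G^\vee$ be the planar dual and $q^*$ the dual vertex of the outer face. Superimpose $G$ and $G^\vee$ so that each edge $e$ of $G$ crosses exactly its dual edge $e^*$, place a new vertex $w_e$ at each crossing, so each edge of $G$ and of $G^\vee$ is split into two half-edges; then delete $q$, $q^*$ and all half-edges incident to them. The resulting planar bipartite graph is $G^+$. Its white vertices are $W=\{w_e: e\in E(G)\}$; its black vertices are the vertices of $G$ other than $q$ and the bounded faces of $G$. Every edge of $G^+$ is a half-edge of an edge of $G$ or of $G^\vee$. $M(G^+)$ is the set of perfect matchings of $G^+$. For a spanning tree $T$ of $G$, the orientation $O_T$ of $G$ orients each edge of $T$ away from $q$ and each edge $e\notin T$ counterclockwise around the unique cycle in $T\cup\{e\}$. Given an orientation $O$ of $G$, the induced orientation $\widehat O$ of $G^+$ is: each half-edge of an edge $e$ of $G$ is oriented in the direction of $e$ in $O$; each half-edge of a dual edge $e^*$ is oriented in the direction of $e^*$, where $e^*$ is oriented as the $90^\circ$ counterclockwise rotation of the $O$-direction of $e$. An edge of $G^+$ is positively oriented if it points from its white endpoint to its black endpoint, negatively oriented otherwise. The Temperley matching $M_T$ consists of, for each $e\in T$, the positively oriented (in $\widehat{O_T}$) half-edge of $e$ at $w_e$, and for each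 $e\notin T$, the positively oriented half-edge of $e^*$ at $w_e$; $T\mapsto M_T$ is a bijection from spanning trees of $G$ to $M(G^+)$. Kasteleyn cokernel: for a $q$-connected orientation $O$ (e.g. $O_T$) and each black vertex $b$ let $r_b\in\mathbb Z^W$ have $w$-coordinate equal to (number of edges between $w$ and $b$ oriented $w\to b$ in $\widehat O$) minus (number oriented $b\to w$). $\mathrm{Prin}(G^+)$ is the subgroup of $\mathbb Z^W$ generated by the $r_b$, and $K(G^+)=\mathbb Z^W/\mathrm{Prin}(G^+)$. For a reference perfect matching $M_0=M_{T_0}$, use the orientation $\widehat{O_{T_0}}$. For $M\in M(G^+)$, $M_0\triangle M$ is a disjoint union of cycles; define $d\in\mathbb Z^W$ by $d(w)=1$ if $w$ lies on $M_0\triangle M$ and its two incident edges in $M_0\triangle M$ have opposite orientations (one positively, one negatively oriented), and $d(w)=0$ otherwise; $\Psi_{M_0}(M)=[d]\in K(G^+)$. *)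

(* Defs.v *)
From HB Require Import structures.
From mathcomp Require Import all_boot all_order all_algebra.
Set Implicit Arguments. Unset Strict Implicit. Unset Printing Implicit Defensive.
Import Order.TTheory GRing.Theory Num.Theory.

(* A plane graph G is given combinatorially by a (spherical) map:           *)
(*  - darts (half-edges) with the fixed-point-free involution [alpha]       *)
(*    (the two darts of an edge) and the permutation [sigma] which rotates  *)
(*    the darts around their tail vertex COUNTERCLOCKWISE;                  *)
(*  - a dart d is the edge [edge d] oriented from [vert d] to              *)
(*    [vert (alpha d)];                                                     *)
(*  - faces are the orbits of [sigma \o alpha]; [face d] is the face lying  *)
(*    to the RIGHT of the dart d (so [face (alpha d)] is the face to its    *)
(*    left).                                                                *)
(* The types [vtx], [fce], [edg] are the vertex, face and edge sets; the    *)
(* maps [vert], [face], [edge] identify them with the corresponding orbits. *)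
Record cmap := CMap {
  dart : finType;
  vtx : finType;
  fce : finType;
  edg : finType;
  alpha : dart -> dart;
  sigma : dart -> dart;
  vert : dart -> vtx;
  face : dart -> fce;
  edge : dart -> edg
}.

Definition phi (G : cmap) : dart G -> dart G := fun d => sigma (alpha d).

Definition adjS (G : cmap) (S : {set edg G}) : rel (vtx G) :=
  fun u v => [exists d : dart G, [&& edge d \in S, vert d == u & vert (alpha d) == v]].

(* G is a finite connected loopless plane (multi)graph, presented as a      *)
(* connected map of genus 0 (Euler's formula).  A graph with no edge (one   *)
(* vertex, one face) is allowed.                                            *)
Definition plane_map (G : cmap) : Prop :=
  (forall d : dart G, alpha (alpha d) = d) /\
      (forall d : dart G, alpha d <> d) /\
      injective (@sigma G) /\
      (forall x y, vert x = vert y <-> fconnect (@sigma G) x y) /\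
      (forall x y, face x = face y <-> fconnect (@phi G) x y) /\
      (forall x y : dart G, edge x = edge y <-> (y = x \/ y = alpha x)) /\
      (forall e : edg G, exists d, edge d = e) /\
      (forall f : fce G, (exists d, face d = f) \/ #|dart G| = 0) /\
      (forall d : dart G, vert (alpha d) <> vert d)            (* no loops *) /\
      (forall u v, connect (adjS [set: edg G]) u v)           (* connected *) /\
    (#|vtx G| + #|fce G| = #|edg G| + 2)%N                  (* planar *).

Definition on_outer (G : cmap) (q : vtx G) (qs : fce G) : Prop :=
  (exists d, vert d = q /\ face d = qs) \/ #|dart G| = 0.

(* White vertices: the edges of G (w_e).  Black vertices: the vertices of G *)
(* other than q and the faces other than qs (inl = vertex, inr = face).     *)
(* Edges of G^+ (half-edges): [inl d] is the half of [edge d] joining w_e   *)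
(* to [vert d]; [inr d] is the half of the dual edge joining w_e to         *)
(* [face d].  Half-edges incident to q or qs are deleted ([hvalid]).        *)
Definition black_t (G : cmap) := (vtx G + fce G)%type.
Definition hedgeP (G : cmap) := (dart G + dart G)%type.

Definition is_black (G : cmap) (q : vtx G) (qs : fce G) (b : black_t G) : bool :=
  match b with inl v => v != q | inr f => f != qs end.

Definition hdart (G : cmap) (h : hedgeP G) : dart G :=
  match h with inl d => d | inr d => d end.

Definition hwhite (G : cmap) (h : hedgeP G) : edg G := edge (hdart h).

Definition hblack (G : cmap) (h : hedgeP G) : black_t G :=
  match h with inl d => inl (vert d) | inr d => inr (face d) end.

Definition hvalid (G : cmap) (q : vtx G) (qs : fce G) (h : hedgeP G) : bool :=
  is_black q qs (hblack h).

Definition perfect_matching (G : cmap) (q : vtx G) (qs : fce G) (M : {set hedgeP G}) : Prop :=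
  [/\ (forall h, h \in M -> hvalid q qs h),
      (forall w : edg G, #|[set h in M | hwhite h == w]| = 1%N)
    & (forall b : black_t G, is_black q qs b -> #|[set h in M | hblack h == b]| = 1%N)].

(* An orientation of G is the set O of darts pointing in the chosen         *)
(* direction of their edge.                                                 *)
Definition orientation (G : cmap) (O : {set dart G}) : Prop :=
  forall d, (d \in O) != (alpha d \in O).

(* Induced orientation of G^+.  For a dart d, the edge e = edge d is        *)
(* oriented from vert d to vert (alpha d) iff d \in O; then e^* (rotation   *)
(* by 90 degrees counterclockwise) goes from the face on the right of d,    *)
(* face d, to the face on its left, face (alpha d).  Hence for both the     *)
(* primal half-edge [inl d] and the dual half-edge [inr d], the half-edge   *)
(* points away from its black endpoint iff d \in O.                          *)
Definition parent_points_away (G : cmap) (O : {set dart G}) (h : hedgeP G) : bool :=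
  match h with
  | inl d => d \in O   (* e goes vert d -> vert (alpha d) *)
  | inr d => d \in O   (* e^* goes face d -> face (alpha d) *)
  end.

Definition positive (G : cmap) (O : {set dart G}) (h : hedgeP G) : bool :=
  ~~ parent_points_away O h.

Definition spanning_tree (G : cmap) (T : {set edg G}) : Prop :=
  (forall u v, connect (adjS T) u v) /\
  (forall d, edge d \in T -> ~~ connect (adjS (T :\ edge d)) (vert d) (vert (alpha d))).

Definition fund_cycle (G : cmap) (T : {set edg G}) (e : edg G) : {set edg G} :=
  e |: [set f in T | [exists d, (edge d == e) &&
          ~~ connect (adjS (T :\ f)) (vert d) (vert (alpha d))]].

Definition fadjS (G : cmap) (C : {set edg G}) : rel (fce G) :=
  fun f g => [exists d : dart G, [&& edge d \notin C, face d == f & face (alpha d) == g]].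

Definition inside (G : cmap) (qs : fce G) (C : {set edg G}) (f : fce G) : bool :=
  ~~ connect (fadjS C) qs f.

(* O_T: tree edges away from q; other edges counterclockwise around their   *)
(* fundamental cycle, i.e. with the inside of the cycle on their left.      *)
Definition orientT (G : cmap) (q : vtx G) (qs : fce G) (T : {set edg G}) : {set dart G} :=
  [set d : dart G | if edge d \in T
                    then connect (adjS (T :\ edge d)) q (vert d)
                    else inside qs (fund_cycle T (edge d)) (face (alpha d))].

Definition temperley (G : cmap) (q : vtx G) (qs : fce G) (T : {set edg G}) : {set hedgeP G} :=
  [set h : hedgeP G | positive (orientT q qs T) h &&
     match h with inl d => edge d \in T | inr d => edge d \notin T end].

Local Open Scope ring_scope.

Definition rvec (G : cmap) (q : vtx G) (qs : fce G) (O : {set dart G}) (b : black_t G)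
  : {ffun edg G -> int} :=
  [ffun w => (#|[set h | [&& hvalid q qs h, hwhite h == w, hblack h == b & positive O h]]|%:Z
            - #|[set h | [&& hvalid q qs h, hwhite h == w, hblack h == b & ~~ positive O h]]|%:Z)].

Definition in_prin (G : cmap) (q : vtx G) (qs : fce G) (O : {set dart G})
  (x : {ffun edg G -> int}) : Prop :=
  exists c : {ffun black_t G -> int},
    forall w : edg G, x w = \sum_(b | is_black q qs b) c b * rvec q qs O b w.

Definition psi_vec (G : cmap) (O : {set dart G}) (M0 M : {set hedgeP G}) : {ffun edg G -> int} :=
  let S := (M0 :\: M) :|: (M :\: M0) in
  [ffun w => if [exists h1, exists h2, [&& h1 \in S, h2 \in S, hwhite h1 == w,
                    hwhite h2 == w & positive O h1 != positive O h2]]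
             then 1 else 0].

(* Main.v *)
(* A matching M orients every edge of G: the edge has the vertex it is matched
   with as its head, or the face it is matched with on its left.  Psi(M) is the
   set of edges on which this orientation differs from the one of M0, and Prin
   consists of the sums of a gradient of a vertex potential and a curl of a face
   potential.

   The central fact: if M and M' induce the same orientation, let Z be the set
   of corners whose vertex and face both reach q and q* along the half-edges
   common to M and M'.  Z is invariant under the tour that walks around the
   primal edges of M, so the variation of its indicator function across the
   edges splits into two flows supported on branchings.  These vanish, so Z
   contains all corners; thus M = M', and (with M' = M) M consists of two
   branchings rooted at q and q*.  The incidence of q with q* makes Z nonempty.

   Injectivity: if Psi(M) - Psi(M') is a gradient plus a curl, orthogonality
   and integrality force each of them to be monotone along both branchings.

   Surjectivity: |K| <= |det A| <= #matchings for the Kasteleyn matrix A,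
   bounding the determinant term by term without examining signs. *)

Require Import Defs.
From HB Require Import structures.
From mathcomp Require Import all_boot all_order all_algebra.
From mathcomp Require Import all_fingroup zify ring.
Set Implicit Arguments. Unset Strict Implicit. Unset Printing Implicit Defensive.
Import Order.TTheory GRing.Theory Num.Theory.
Local Open Scope ring_scope.

(** * Cosets of a full-rank lattice *)

Lemma foldr_mul_prod (I : finType) (F : I -> nat) :
  foldr muln 1%N [seq F i | i : I] = (\prod_i F i)%N.
Proof. by rewrite foldrE big_map big_enum. Qed.

(* The Smith normal form shows that a full-rank lattice A Z^n has at most
   |det A| cosets; pairwise incongruent vectors in at least that number
   therefore represent all of them. *)
Lemma lattice_transversal n (A : 'M[int]_n) (I : finType) (P : {set I})
    (v : I -> 'cV[int]_n) :
  (forall c : 'cV_n, A *m c = 0 -> c = 0) ->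
  (`|\det A| <= #|P|)%N ->
  {in P &, forall i j, (exists c, v i - v j = A *m c) -> i = j} ->
  forall x, exists2 i, i \in P & exists c, x - v i = A *m c.
Proof.
move=> Akr Adet vinj x.
have [L Lu [R Ru [d _ defA]]] := int_Smith_normal_form A.
set D := (\matrix_(i, j) _) in defA.
have d_neq0 (i : 'I_n) : d`_i != 0.
  apply/eqP=> di0; have : invmx R *m delta_mx i 0 = 0 :> 'cV_n.
    apply: Akr; rewrite defA -!mulmxA mulKVmx //.
    suff -> : D *m delta_mx i 0 = 0 :> 'cV_n by rewrite mulmx0.
    apply/matrixP=> k l; rewrite !mxE big1 // => j _; rewrite !mxE.
    case: (j =P i) => [->|_]; rewrite ?mulr0 //.
    by case: (k =P i :> nat) => [->|_]; rewrite ?di0 ?mul0rn ?mul0r.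
  move/(congr1 (mulmx R)); rewrite mulKVmx // mulmx0 => /matrixP/(_ i 0).
  by rewrite !mxE !eqxx.
have detA : `|\det A|%N = (\prod_(i < n) `|(d`_i)%R|)%N.
  have abs1 (U : 'M[int]_n) : U \in unitmx -> `|\det U|%N = 1%N.
    by rewrite unitmxE => /orP[]/eqP->.
  rewrite defA !det_mulmx !abszM (abs1 _ Lu) (abs1 _ Ru) mul1n muln1.
  have -> : D = diag_mx (\row_i d`_i).
    by apply/matrixP=> i j; rewrite !mxE; congr (_ *+ _).
  rewrite det_diag (big_morph _ abszM absz1).
  by apply: eq_bigr => i _; rewrite mxE.
(* The box of residue vectors modulo the invariant factors, with [|\det A|] elements. *)
pose Q := {dffun forall i : 'I_n, 'I_`|(d`_i)%R|}.
have cardQ : #|Q| = `|\det A|%N.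
  by rewrite detA card_dep_ffun foldr_mul_prod; apply: eq_bigr => i _; rewrite card_ord.
have res_lt (y : 'cV[int]_n) (i : 'I_n) :
    (`|modz ((invmx L *m y) i ord0) (d`_i)%R| < `|(d`_i)%R|)%N.
  have := ltz_mod ((invmx L *m y) i 0) (d_neq0 i).
  by have := modz_ge0 ((invmx L *m y) i 0) (d_neq0 i); lia.
pose res y : Q := [ffun i => Ordinal (res_lt y i)].
have resP y z : res y = res z -> exists c, y - z = A *m c.
  move=> eq_res.
  exists (invmx R *m \col_i (divz ((invmx L *m (y - z)) i 0) d`_i)).
  rewrite defA -!mulmxA mulKVmx //.
  suff -> : D *m \col_i (divz ((invmx L *m (y - z)) i 0) d`_i) = invmx L *m (y - z).
    by rewrite mulKVmx.
  apply/matrixP=> i j; rewrite ord1 mxE (bigD1 i) //= big1 ?addr0; last first.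
    by move=> k ki; rewrite !mxE eq_sym (val_eqE k i) (negPf ki) mul0r.
  rewrite [D i i]mxE [(\col__ _) i 0]mxE eqxx mulr1n mulrC divzK //.
  have /(congr1 val)/= := congr1 (fun f : Q => f i) eq_res.
  rewrite !ffunE /= => /(congr1 Posz); rewrite !gez0_abs ?modz_ge0 // => /eqP.
  by rewrite eqz_mod_dvd mulmxBr !mxE.
have res_inj : {in P &, injective (res \o v)}.
  by move=> i j Pi Pj /resP; apply: vinj.
have /imsetP[i Pi res_x] : res x \in (res \o v) @: P.
  (* Residues are injective on [P], which is at least as large as [Q], so every residue occurs. *)
  suff -> : (res \o v) @: P = setT by rewrite inE.
  apply/eqP; rewrite eqEcard subsetT cardsT cardQ card_in_imset //.
by exists i => //; apply: resP.
Qed.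

(** In the Leibniz expansion, the term of each permutation is bounded by a product of cardinals,
    which counts choice functions. *)
Lemma norm_det_le n (T : finType) (A : 'M[int]_n) (H : 'I_n -> 'I_n -> {set T}) :
  (forall i j, (`|A i j| <= #|H i j|)%N) ->
  (`|\det A| <= #|[set p : ('S_n * {ffun 'I_n -> T})%type |
                    [forall i, p.2 i \in H i (p.1 i)]]|)%N.
Proof.
move=> leAH; rewrite -sum1dep_card.
rewrite -(pair_big_dep xpredT (fun (s : 'S_n) (k : {ffun 'I_n -> T}) =>
  [forall i, k i \in H i (s i)]) (fun _ _ => 1%N)) /=.
rewrite -lez_nat abszE; apply: le_trans (ler_norm_sum _ _ _) _.
rewrite -natz natr_sum; apply: ler_sum => s _.
rewrite normrM normrX normrN1 expr1n mul1r normr_prod sum1dep_card.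
have -> : #|[set k : {ffun 'I_n -> T} | [forall i, k i \in H i (s i)]]| =
          (\prod_i #|H i (s i)|)%N.
  rewrite -foldr_mul_prod -(card_family (rT := fun=> T) (fun i => mem (H i (s i)))).
  by apply: eq_card => k; rewrite inE; apply/forallP/familyP.
by rewrite natr_prod; apply: ler_prod => i _; rewrite normr_ge0 natz -abszE lez_nat leAH.
Qed.

(** * Flows on branchings *)

Section Branching.

Variables (D X : finType) (vt : D -> X) (al : D -> D) (r : X).
Hypothesis alK : involutive al.

(** A vertex without an arc in [C] is a fixed point, so a path that stops short of [r] never makes
    its start [rooted]. *)
Definition parent (C : {set D}) (x : X) : X :=
  if [pick d in C | vt d == x] is Some d then vt (al d) else x.

Definition rooted (C : {set D}) (x : X) : bool := fconnect (parent C) x r.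

Variable C : {set D}.
Hypothesis C_inj : {in C &, injective vt}.
Hypothesis C_root : {in C, forall d, vt d != r}.

Lemma parentE d : d \in C -> parent C (vt d) = vt (al d).
Proof.
move=> Cd; rewrite /parent; case: pickP => [d' /andP[Cd' /eqP/C_inj->//]|/(_ d)].
by rewrite Cd eqxx.
Qed.

Lemma rooted_root : rooted C r. Proof. exact: connect0. Qed.

Lemma rooted_arc d : d \in C -> rooted C (vt d) = rooted C (vt (al d)).
Proof.
by move=> Cd; rewrite /rooted fconnect_eqVf parentE // (negPf (C_root Cd)).
Qed.

Lemma rooted_ex x : rooted C x -> x != r -> exists2 d, d \in C & vt d = x.
Proof.
move=> /iter_findex; set n := findex _ _ _ => + x_r.
case E: [pick d in C | vt d == x] => [d|].
  by move: E; case: pickP => // d' /andP[Cd' /eqP vd'] _ _; exists d'.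
have fixx : parent C x = x by rewrite /parent E.
suff -> : iter n (parent C) x = x by move/eqP; rewrite (negPf x_r).
by elim: n => //= n ->.
Qed.

Lemma rooted_mono (f : X -> int) x :
  {in C, forall d, f (vt d) <= f (vt (al d))} -> rooted C x -> f x <= f r.
Proof.
move=> f_mono /iter_findex <-; elim: findex => //= n; move/le_trans; apply.
rewrite /parent; case: pickP => // d /andP[Cd /eqP <-]; exact: f_mono.
Qed.

(* At a vertex of maximal depth the only arc that can carry flow is the one
   towards the root. *)
Lemma flow_on_branching_eq0 (z : D -> int) :
  (forall d, z (al d) = - z d) ->
  (forall x, \sum_(d | vt d == x) z d = 0) ->
  (forall d, z d != 0 -> ((d \in C) || (al d \in C)) && rooted C (vt d)) ->
  forall d, z d = 0.
Proof.
move=> z_al z_div z_supp d0; apply/eqP/negPn/negP => z0.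
pose P := [pred d | (d \in C) && (z d != 0)].
have [d Pd] : exists d, P d.
  have /andP[/orP[Cd|Cd] _] := z_supp _ z0; first by exists d0; rewrite /P /= Cd.
  by exists (al d0); rewrite /P /= Cd z_al oppr_eq0.
pose depth x := findex (parent C) x r.
case: (arg_maxnP (fun d => depth (vt d)) Pd) => {Pd}d /= /andP[Cd zd] dmax.
have /eqP := z_div (vt d); rewrite (bigD1 d) //= big1 ?addr0 ?(negPf zd) // => y.
case/andP=> /eqP vy yd; apply/eqP/negPn/negP => zy.
have /andP[/orP[Cy|Cy] ry] := z_supp _ zy.
  by rewrite (C_inj Cy Cd vy) eqxx in yd.
have /dmax : P (al y) by rewrite /P /= Cy z_al oppr_eq0.
apply/negP; rewrite -ltnNge /depth.
have ray : rooted C (vt (al y)) by rewrite rooted_arc // alK.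
by rewrite (fconnect_findex ray) 1?eq_sym ?C_root // parentE // alK vy.
Qed.

End Branching.

(** * Plane maps and perfect matchings *)

Section PlaneMap.

Variables (G : cmap) (q : vtx G) (qs : fce G).
Hypothesis HG : plane_map G.
Hypothesis Hq : on_outer q qs.

Local Notation al := (@alpha G).
Local Notation sg := (@sigma G).
Local Notation matching := (@perfect_matching G q qs).

Lemma alK : involutive al. Proof. by case: HG. Qed.

Lemma al_inj : injective al. Proof. exact: inv_inj alK. Qed.

Lemma al_neq (d : dart G) : al d != d.
Proof. by case: HG => _ [+ _] => /(_ d) /eqP. Qed.

Lemma sg_inj : injective sg. Proof. by case: HG => _ [_ []]. Qed.

Lemma phi_inj : injective (@phi G).
Proof. exact: inj_comp sg_inj al_inj. Qed.

Lemma vert_eq (x y : dart G) : vert x = vert y <-> fconnect sg x y.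
Proof. by case: HG => _ [_ [_ []]]. Qed.

Lemma vert_sg (d : dart G) : vert (sg d) = vert d.
Proof. by apply/esym/vert_eq/fconnect1. Qed.

Lemma face_phi (d : dart G) : face (sg (al d)) = face d.
Proof. by case: HG => _ [_ [_ [_ [/(_ d (phi d))[_ /(_ (fconnect1 _ _))->] _]]]]. Qed.

Lemma face_sg (d : dart G) : face (sg d) = face (al d).
Proof. by rewrite -{1}(alK d) face_phi. Qed.

Lemma edge_eq (x y : dart G) : edge x = edge y <-> y = x \/ y = al x.
Proof. by case: HG => _ [_ [_ [_ [_ []]]]]. Qed.

Lemma edge_al (d : dart G) : edge (al d) = edge d.
Proof. by apply/esym/edge_eq; right. Qed.

Lemma map_connected (u v : vtx G) : connect (adjS [set: edg G]) u v.
Proof. by case: HG => _ [_ [_ [_ [_ [_ [_ [_ [_ []]]]]]]]]. Qed.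

Lemma map_euler : (#|vtx G| + #|fce G| = #|edg G| + 2)%N.
Proof. by case: HG => _ [_ [_ [_ [_ [_ [_ [_ [_ []]]]]]]]]. Qed.

(** Closure under [sigma] fills whole vertex stars, and [alpha] passes between stars along a path of
    [G]. *)
Lemma dart_closed (Z : {set dart G}) (d0 : dart G) :
  d0 \in Z -> (forall d, d \in Z -> (al d \in Z) && (sg d \in Z)) ->
  forall d, d \in Z.
Proof.
move=> Z0 Zcl d.
have Zvert x y : x \in Z -> vert x = vert y -> y \in Z.
  move=> Zx /vert_eq /iter_findex <-; elim: findex => //= n Zn.
  by have /andP[] := Zcl _ Zn.
have [p] := connectP (map_connected (vert d0) (vert d)).
elim: p d0 Z0 => [|v p IHp] x Zx /=; first by move=> _ /esym; apply: Zvert.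
case/andP=> /existsP[y /and3P[_ /eqP vy /eqP vay]]; rewrite -vay; apply: IHp.
by have /andP[] := Zcl _ (Zvert _ _ Zx (esym vy)).
Qed.

(** Orthogonality of gradients and curls: [sigma] keeps the vertex and turns [face d] into
    [face (alpha d)], so reindexing by [sigma] and [alpha] cancels the four terms. *)
Lemma sum_potential_orth (f : vtx G -> int) (g : fce G -> int) :
  \sum_(d : dart G) (f (vert (al d)) - f (vert d)) * (g (face (al d)) - g (face d)) = 0.
Proof.
pose S1 := \sum_(d : dart G) f (vert d) * g (face d).
pose S2 := \sum_(d : dart G) f (vert d) * g (face (al d)).
have S12 : S1 = S2.
  rewrite /S1 (reindex_inj sg_inj) /=; apply: eq_bigr => d _.
  by rewrite vert_sg face_sg.
have S1a : S1 = \sum_(d : dart G) f (vert (al d)) * g (face (al d)).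
  exact: (reindex_inj al_inj).
have S2a : S2 = \sum_(d : dart G) f (vert (al d)) * g (face d).
  rewrite /S2 (reindex_inj al_inj) /=; apply: eq_bigr => d _.
  by rewrite alK.
transitivity (S1 + S1 - S2 - S2); last by rewrite S12; ring.
rewrite {1}S1a {1}S2a /S1 /S2 -!sumrN -!big_split /=.
by apply: eq_bigr => d _; ring.
Qed.

(** * The orientation induced by one matching *)

Section Matching.

Variables (M : {set hedgeP G}).
Hypothesis HM : matching M.

Lemma matching_valid h : h \in M -> hvalid q qs h.
Proof. by case: HM => + _ _; apply. Qed.

Lemma matching_white_ex w : exists2 h, h \in M & hwhite h = w.
Proof.
case: HM => _ /(_ w)/eqP/cards1P[h /setP/(_ h)] + _.
by rewrite !inE eqxx => /andP[Mh /eqP]; exists h.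
Qed.

Lemma matching_white_inj : {in M &, injective (@hwhite G)}.
Proof.
move=> h h' Mh Mh' eqw; case: HM => _ /(_ (hwhite h))/eqP/cards1P[k /setP Ek] _.
have := Ek h; have := Ek h'.
by rewrite !inE Mh Mh' eqw eqxx => /esym/eqP-> /esym/eqP->.
Qed.

Lemma matching_black_ex b : is_black q qs b -> exists2 h, h \in M & hblack h = b.
Proof.
case: HM => _ _ /(_ b) /[apply] /eqP/cards1P[h /setP/(_ h)].
by rewrite !inE eqxx => /andP[Mh /eqP]; exists h.
Qed.

Lemma matching_black_inj : {in M &, injective (@hblack G)}.
Proof.
move=> h h' Mh Mh' eqb.
case: HM => Mv _ /(_ (hblack h) (Mv h Mh))/eqP/cards1P[k /setP Ek].
have := Ek h; have := Ek h'.
by rewrite !inE Mh Mh' eqb eqxx => /esym/eqP-> /esym/eqP->.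
Qed.

(* The orientation making all of M positive is the complement of [heads]. *)
Definition heads : {set dart G} := [set @hdart G h | h in M].

Lemma headsE d : (d \in heads) = (inl d \in M) || (inr d \in M).
Proof.
apply/imsetP/orP => [[[d'|d'] Md ->]|[]Md]; [by left|by right| |].
  by exists (inl d).
by exists (inr d).
Qed.

Lemma heads_al d : (al d \in heads) = (d \notin heads).
Proof.
have [h Mh wh] := matching_white_ex (edge d).
have hd : hdart h \in heads by apply: imset_f.
have uniq_hd x : x \in heads -> edge x = edge d -> x = hdart h.
  case/imsetP=> h' Mh' -> wh'; congr hdart.
  by apply: matching_white_inj; rewrite // wh.
have /esym/edge_eq [hdE|hdE] := wh; rewrite hdE in hd uniq_hd.
  rewrite hd; apply/negP => /uniq_hd; rewrite edge_al => /(_ erefl)/eqP.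
  by rewrite (negPf (al_neq d)).
rewrite hd; apply/esym/negP => /uniq_hd /(_ erefl)/eqP.
by rewrite eq_sym (negPf (al_neq d)).
Qed.

Lemma matching_excl d : inl d \in M -> inr d \notin M.
Proof. by move=> Ml; apply/negP => Mr; have := matching_white_inj Ml Mr erefl. Qed.

End Matching.

(** * Two matchings inducing the same orientation *)

Section Tour.

Variables (M M' : {set hedgeP G}).
Hypotheses (HM : matching M) (HM' : matching M').
Hypothesis same_heads : heads M = heads M'.

Definition common_primal := [set d : dart G | (inl d \in M) && (inl d \in M')].
Definition common_dual := [set d : dart G | (inr d \in M) && (inr d \in M')].
Local Notation vroot := (rooted (@vert G) al q common_primal).
Local Notation froot := (rooted (@face G) al qs common_dual).

Lemma common_primal_inj : {in common_primal &, injective (@vert G)}.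
Proof.
move=> x y; rewrite !inE => /andP[Mx _] /andP[My _] eqv.
by have [] : inl x = inl y :> hedgeP G by apply: (matching_black_inj HM); rewrite //= eqv.
Qed.

Lemma common_dual_inj : {in common_dual &, injective (@face G)}.
Proof.
move=> x y; rewrite !inE => /andP[Mx _] /andP[My _] eqf.
by have [] : inr x = inr y :> hedgeP G by apply: (matching_black_inj HM); rewrite //= eqf.
Qed.

Lemma common_primal_root : {in common_primal, forall d, vert d != q}.
Proof. by move=> d; rewrite inE => /andP[/(matching_valid HM)]. Qed.

Lemma common_dual_root : {in common_dual, forall d, face d != qs}.
Proof. by move=> d; rewrite inE => /andP[/(matching_valid HM)]. Qed.

(** A rooted vertex other than [q] has an arc in [common_primal], and uniqueness of its partner in
    [M] or [M'] identifies that arc with [d]. *)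
Lemma vroot_common d :
  (inl d \in M) || (inl d \in M') -> vroot (vert d) -> d \in common_primal.
Proof.
move=> Md vd; have v_q : vert d != q.
  by case/orP: Md => [/(matching_valid HM)|/(matching_valid HM')].
have [x Cx vx] := rooted_ex vd v_q; have := Cx; rewrite inE => /andP[Mx M'x].
suff [<-] : inl x = inl d :> hedgeP G by [].
by case/orP: Md => Md; [apply: (matching_black_inj HM)|apply: (matching_black_inj HM')];
  rewrite //= vx.
Qed.

Lemma froot_common d :
  (inr d \in M) || (inr d \in M') -> froot (face d) -> d \in common_dual.
Proof.
move=> Md fd; have f_q : face d != qs.
  by case/orP: Md => [/(matching_valid HM)|/(matching_valid HM')].
have [x Cx fx] := rooted_ex fd f_q; have := Cx; rewrite inE => /andP[Mx M'x].
suff [<-] : inr x = inr d :> hedgeP G by [].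
by case/orP: Md => Md; [apply: (matching_black_inj HM)|apply: (matching_black_inj HM')];
  rewrite //= fx.
Qed.

Definition tree_dart d := (inl d \in M) || (inl (al d) \in M).
(** The tour follows a tree edge along its left side to the far vertex and crosses any other edge to
    the face on its right. *)
Definition tour_step d := if tree_dart d then al d else d.
Definition rooted_corners := [set d : dart G | vroot (vert d) && froot (face d)].
Local Notation Z := rooted_corners.

Lemma tree_dart_al d : tree_dart (al d) = tree_dart d.
Proof. by rewrite /tree_dart alK orbC. Qed.

Lemma tour_stepK : involutive tour_step.
Proof.
move=> d; rewrite /tour_step; case: (boolP (tree_dart d)) => td.
  by rewrite tree_dart_al td alK.
by rewrite (negPf td).
Qed.

(* The corner of a dart d is the one at [vert d] in [face d].  In the clockwise
   tour around the primal part of M, the corner of [sg d] is followed by that of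
   [tour_step d].  At a corner of Z, the edge met by the tour has its M- and
   M'-partners among its head and its left face, one of which lies at that
   corner when the edge points to it, and then M and M' agree on the edge. *)
Lemma rooted_corners_step d : sg d \in Z -> tour_step d \in Z.
Proof.
rewrite inE vert_sg face_sg => /andP[vd fd].
have excl := matching_excl HM.
have M'E x : (inl x \in M') || (inr x \in M') = (inl x \in M) || (inr x \in M).
  by rewrite -!headsE same_heads.
have vC x : x \in common_primal -> vroot (vert x) = vroot (vert (al x)).
  exact: rooted_arc common_primal_inj common_primal_root _.
have fC x : x \in common_dual -> froot (face x) = froot (face (al x)).
  exact: rooted_arc common_dual_inj common_dual_root _.
rewrite /tour_step; case: ifP => [/orP[Md|Mad]|/norP[nMd nMad]]; rewrite inE.
- by rewrite fd andbT -vC // vroot_common // Md.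
- rewrite fd andbT; have /vC : al d \in common_primal; last by rewrite alK vd => ->.
  rewrite inE Mad /=; move: (M'E (al d)); rewrite Mad => /orP[//|M'ad].
  have := froot_common (d := al d); rewrite M'ad orbT => /(_ isT fd).
  by rewrite inE (negPf (excl _ Mad)).
have : (d \in heads M) || (al d \in heads M) by rewrite (heads_al HM) orbN.
rewrite vd !headsE (negPf nMd) (negPf nMad) /= => /orP[Md|Mad]; last first.
  by have /fC := froot_common (introT orP (or_introl Mad)) fd; rewrite alK fd.
suff /fC -> : d \in common_dual by [].
rewrite inE Md /=; move: (M'E d); rewrite Md orbT => /orP[M'd|//].
have := vroot_common (d := d); rewrite M'd orbT => /(_ isT vd).
by rewrite inE (negPf nMd).
Qed.

(** By counting, an inclusion between preimages of a finite set under two permutations is an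
    equality. *)
Lemma rooted_corners_stepE d : (sg d \in Z) = (tour_step d \in Z).
Proof.
have /eqP/setP/(_ d) : sg @^-1: Z == tour_step @^-1: Z; last by rewrite !inE.
rewrite eqEcard !card_preimset ?leqnn ?andbT; [|exact: sg_inj|exact: inv_inj tour_stepK].
apply/subsetP=> x; rewrite in_set => Zx; rewrite in_set.
exact: rooted_corners_step.
Qed.

Lemma tree_dart_common d : tree_dart d -> d \in Z ->
  ((d \in common_primal) || (al d \in common_primal))
    && (vroot (vert d) && vroot (vert (al d))).
Proof.
have vC x : x \in common_primal -> vroot (vert x) = vroot (vert (al x)).
  exact: rooted_arc common_primal_inj common_primal_root _.
move=> td Zd; have /andP[vd fd] : vroot (vert d) && froot (face d) by move: Zd; rewrite inE.
case/orP: (td) => [Md|Mad].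
  have Cd : d \in common_primal by rewrite vroot_common // Md.
  by rewrite Cd -vC // vd.
have : sg (al d) \in Z by rewrite rooted_corners_stepE /tour_step tree_dart_al td alK.
rewrite inE vert_sg => /andP[vad _].
have Cd : al d \in common_primal by rewrite vroot_common // Mad.
by rewrite Cd orbT vd vad.
Qed.

Lemma cotree_dart_common d : ~~ tree_dart d -> d \in Z ->
  ((d \in common_dual) || (al d \in common_dual))
    && (froot (face d) && froot (face (al d))).
Proof.
have fC x : x \in common_dual -> froot (face x) = froot (face (al x)).
  exact: rooted_arc common_dual_inj common_dual_root _.
move=> td Zd; have /andP[vd fd] : vroot (vert d) && froot (face d) by move: Zd; rewrite inE.
(* Here [tour_step] fixes [d], so the corner of [sigma d], whose face lies across [d], is in [Z]
   too. *)
have := Zd; rewrite -{1}[d]/(if false then al d else d) -(negPf td).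
rewrite -[if _ then _ else _]/(tour_step d) -rooted_corners_stepE.
rewrite inE face_sg => /andP[_ fad]; rewrite fd fad !andbT.
have : (d \in heads M) || (al d \in heads M) by rewrite (heads_al HM) orbN.
have /norP[/negPf nMd /negPf nMad] := td.
rewrite !headsE nMd nMad /= => /orP[Md|Mad].
  by rewrite froot_common // Md.
by rewrite (froot_common (d := al d)) ?orbT // Mad.
Qed.

Let a d : int := (d \in Z)%:R.

(** The difference has zero divergence since [sigma] permutes the darts at a vertex. By tour
    invariance it is [a d - a (alpha d)] on tree edges and 0 elsewhere, hence a flow on a
    branching. *)
Lemma corner_flow_eq0 d : a d = a (sg d).
Proof.
have aS x : a (sg x) = a (tour_step x) by rewrite /a rooted_corners_stepE.
apply/eqP; rewrite -subr_eq0; apply/eqP; move: d.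
apply: (flow_on_branching_eq0 alK common_primal_inj common_primal_root).
- move=> d; rewrite !aS /tour_step tree_dart_al.
  by case: ifP => _; rewrite ?alK; ring.
- move=> v; rewrite sumrB [X in _ - X](_ : _ = \sum_(d | vert d == v) a d) ?subrr //.
  rewrite [RHS](reindex_inj sg_inj) /=; apply: eq_bigl => d.
  by rewrite vert_sg.
move=> d; rewrite aS /tour_step; case: ifP => [td|_]; last by rewrite subrr eqxx.
case: (boolP (d \in Z)) => [Zd|nZd].
  by have /and3P[-> -> _] := tree_dart_common td Zd.
case: (boolP (al d \in Z)) => [Zad|nZad]; last first.
  by rewrite /a (negPf nZd) (negPf nZad) subrr eqxx.
have := tree_dart_common _ Zad; rewrite tree_dart_al td alK => /(_ isT).
by case/and3P=> + _ ->; rewrite orbC andbT.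
Qed.

(** Dually, [phi] permutes the darts of a face, and only the edges outside the primal part of [M]
    can carry flow. *)
Lemma cocorner_flow_eq0 d : a d = a (sg (al d)).
Proof.
have aS x : a (sg x) = a (tour_step x) by rewrite /a rooted_corners_stepE.
apply/eqP; rewrite -subr_eq0; apply/eqP; move: d.
apply: (flow_on_branching_eq0 alK common_dual_inj common_dual_root).
- move=> d; rewrite !aS /tour_step !tree_dart_al.
  by case: ifP => _; rewrite ?alK; ring.
- move=> f; rewrite sumrB [X in _ - X](_ : _ = \sum_(d | face d == f) a d) ?subrr //.
  rewrite [RHS](reindex_inj phi_inj) /=; apply: eq_bigl => d.
  by rewrite face_phi.
move=> d; rewrite aS /tour_step tree_dart_al alK; case: ifP => [_|/negbT td].
  by rewrite subrr eqxx.
case: (boolP (d \in Z)) => [Zd|nZd].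
  by have /and3P[-> -> _] := cotree_dart_common td Zd.
case: (boolP (al d \in Z)) => [Zad|nZad]; last first.
  by rewrite /a (negPf nZd) (negPf nZad) subrr eqxx.
have := cotree_dart_common _ Zad; rewrite tree_dart_al td alK => /(_ isT).
by case/and3P=> + _ ->; rewrite orbC andbT.
Qed.

(** The two vanishing flows make [Z] closed under [sigma] and [alpha]; it contains an outer corner
    at [q]. *)
Lemma all_rooted d : vroot (vert d) && froot (face d).
Proof.
suff : d \in Z by rewrite inE.
case: Hq => [[d0 [v0 f0]]|D0]; last first.
  by have := fintype0 d D0.
apply: (dart_closed (d0 := d0)) => [|x Zx].
  by rewrite inE v0 f0 !rooted_root.
have a_inj y z : a y = a z -> (y \in Z) = (z \in Z) by rewrite /a; do 2!case: (_ \in _).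
have -> : (al x \in Z) = (x \in Z).
  by apply: a_inj; rewrite corner_flow_eq0 -cocorner_flow_eq0.
by rewrite -(a_inj _ _ (corner_flow_eq0 x)) Zx.
Qed.

End Tour.

Lemma heads_inj (M M' : {set hedgeP G}) :
  matching M -> matching M' -> heads M = heads M' -> M = M'.
Proof.
have sub N N' : matching N -> matching N' -> heads N = heads N' -> N \subset N'.
  move=> HN HN' hN; apply/subsetP=> -[] d Nd.
    have /andP[vd _] := all_rooted HN HN' hN d.
    by have := vroot_common HN HN' (introT orP (or_introl Nd)) vd; rewrite inE => /andP[].
  have /andP[_ fd] := all_rooted HN HN' hN d.
  by have := froot_common HN HN' (introT orP (or_introl Nd)) fd; rewrite inE => /andP[].
by move=> HM HM' hM; apply/eqP; rewrite eqEsubset !sub.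
Qed.

(* Gradients and curls are orthogonal, so the sum of [df * (df - delta)] is 0;
   each term is nonnegative because [delta] is in {-1, 0, 1}.  Hence [df] has
   the sign of [delta], which makes f monotone towards q along both matchings. *)
Lemma potential_eq0 (M M' : {set hedgeP G}) (f : vtx G -> int) (g : fce G -> int) :
  matching M -> matching M' -> f q = 0 -> g qs = 0 ->
  (forall d : dart G, (f (vert (al d)) - f (vert d)) + (g (face (al d)) - g (face d))
             = (d \in heads M)%:R - (d \in heads M')%:R) ->
  forall d : dart G, f (vert d) = 0 /\ g (face d) = 0.
Proof.
move=> HM HM' fq gqs dfg.
pose df d := f (vert (al d)) - f (vert d).
pose dg d := g (face (al d)) - g (face d).
have dfg0 d : df d * dg d = 0.
  have H : \sum_d - (df d * dg d) = 0 by rewrite sumrN sum_potential_orth oppr0.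
  suff pos x : true -> 0 <= - (df x * dg x).
    by apply/oppr_inj; rewrite oppr0 (psumr_eq0P pos H).
  move=> _; have := dfg x; rewrite -/(df x) -/(dg x).
  by case: (x \in heads M); case: (x \in heads M') => /=; nia.
have df_ge0 d : d \in heads M -> 0 <= df d /\ 0 <= dg d.
  move=> hd; have := dfg d; have := dfg0 d; rewrite -/(df d) -/(dg d) hd.
  by case: (_ \in _) => /=; nia.
have df_le0 d : d \in heads M' -> df d <= 0 /\ dg d <= 0.
  move=> hd; have := dfg d; have := dfg0 d; rewrite -/(df d) -/(dg d) hd.
  by case: (_ \in _) => /=; nia.
move=> d.
(* With both matchings equal, the common half-edges are those of one matching, which thus lead
   everywhere to the roots. *)
have /andP[vd fd] := all_rooted HM HM erefl d.
have /andP[vd' fd'] := all_rooted HM' HM' erefl d.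
have up_f : f (vert d) <= f q.
  apply: rooted_mono vd => x; rewrite inE andbb => Mx.
  by have [] := df_ge0 x; rewrite ?headsE ?Mx // subr_ge0.
have up_g : g (face d) <= g qs.
  apply: rooted_mono fd => x; rewrite inE andbb => Mx.
  by have [] := df_ge0 x; rewrite ?headsE ?Mx ?orbT // !subr_ge0.
(* Along [M'] both potentials decrease towards the roots, which gives the reverse bounds. *)
have dn_f : - f (vert d) <= - f q.
  apply: (@rooted_mono _ _ _ _ _ _ (fun v => - f v)) vd' => x; rewrite inE andbb => Mx.
  by have [] := df_le0 x; rewrite ?headsE ?Mx // lerN2 subr_le0.
have dn_g : - g (face d) <= - g qs.
  apply: (@rooted_mono _ _ _ _ _ _ (fun v => - g v)) fd' => x; rewrite inE andbb => Mx.
  by have [] := df_le0 x; rewrite ?headsE ?Mx ?orbT // lerN2 !subr_le0.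
by move: up_f up_g dn_f dn_g; rewrite fq gqs; lia.
Qed.

(** * The Kasteleyn cokernel *)

Section Orientation.

Variable O : {set dart G}.
Hypothesis HO : forall d, (al d \in O) = (d \notin O).

(** The value 0 at [q] and [qs] lets sums run over all four half-edges of an edge, deleted or
    not. *)
Definition potential (c : black_t G -> int) (b : black_t G) : int :=
  if is_black q qs b then c b else 0.

Lemma positiveE h : positive O h = (hdart h \notin O). Proof. by case: h. Qed.

Lemma rvecE b w :
  rvec q qs O b w = \sum_(h | [&& hvalid q qs h, hwhite h == w & hblack h == b])
                      (-1) ^+ (hdart h \in O).
Proof.
have cardE (P : pred (hedgeP G)) : #|[set h | P h]|%:Z = \sum_(h | P h) 1.
  by rewrite -natz -sumr_const; apply: eq_bigl => h; rewrite inE.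
rewrite ffunE !cardE [RHS](bigID (positive O)) /= -sumrN.
congr (_ + _); apply: eq_big => h; rewrite ?andbA // => /andP[_].
  by rewrite positiveE => /negPf->.
by rewrite positiveE negbK => ->.
Qed.

Lemma rvec_norm_le b w : is_black q qs b ->
  (`|rvec q qs O b w| <= #|[set h : hedgeP G | (hwhite h == w) && (hblack h == b)]|)%N.
Proof.
move=> bb; rewrite -lez_nat abszE rvecE; apply: le_trans (ler_norm_sum _ _ _) _.
rewrite (eq_bigr (fun=> 1)) => [|h _]; last by rewrite normrX normrN1 expr1n.
rewrite sumr_const natz lez_nat; apply: subset_leq_card.
by apply/subsetP=> h; rewrite !inE => /and3P[_ -> ->].
Qed.

Lemma sum_edge (F : dart G -> int) d : \sum_(x | edge x == edge d) F x = F d + F (al d).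
Proof.
rewrite (bigD1 d) //= (bigD1 (al d)) /= ?big1 ?addr0 ?edge_al ?eqxx ?al_neq //.
by move=> x /andP[/andP[/eqP/esym/edge_eq[->|->]]]; rewrite eqxx.
Qed.

(** After exchanging sums, the two half-edges of [d] carry the sign -1 and those of [alpha d] the
    sign +1. *)
Lemma prin_potential (c : black_t G -> int) d : d \in O ->
  \sum_(b | is_black q qs b) c b * rvec q qs O b (edge d) =
    (potential c (inl (vert (al d))) - potential c (inl (vert d)))
    + (potential c (inr (face (al d))) - potential c (inr (face d))).
Proof.
move=> dO.
transitivity (\sum_(h | hwhite h == edge d)
                 potential c (@hblack G h) * (-1) ^+ (hdart h \in O)).
  under eq_bigr do rewrite rvecE mulr_sumr.
  rewrite (exchange_big_dep (fun h => hwhite h == edge d)) /=; last first.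
    by move=> b h _ /and3P[].
  apply: eq_bigr => h /eqP wh; rewrite /potential -/(hvalid q qs h).
  rewrite (eq_bigl (fun b => hvalid q qs h && (b == hblack h))); last first.
    move=> b; rewrite wh eqxx /= [hblack h == b]eq_sym; case: eqP => [->|_].
      by rewrite -/(hvalid q qs h) !andbT andbb.
    by rewrite !andbF.
  case: (hvalid q qs h) => /=; last by rewrite big_pred0 ?mul0r.
  by rewrite big_pred1_eq.
rewrite big_sumType /= !sum_edge /= HO dO /=; ring.
Qed.

Variable M0 : {set hedgeP G}.
Hypothesis HM0 : matching M0.
Hypothesis M0_pos : {in M0, forall h, positive O h}.

(** All of [M0] is positive, so signs differ at an edge exactly when [M] has a negative half-edge
    there. *)
Lemma psi_vecE M d : matching M -> d \in O ->
  psi_vec O M0 M (edge d) = (d \in heads M)%:R.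
Proof.
move=> HM dO; rewrite ffunE.
have neg_M h : h \in (M0 :\: M) :|: (M :\: M0) -> hwhite h = edge d ->
    ~~ positive O h -> d \in heads M.
  rewrite !inE => Sh /esym/edge_eq hd hneg.
  have hM : h \in M by case/orP: Sh => /andP[_] // /M0_pos; rewrite (negPf hneg).
  case: hd => hd; first by rewrite -hd imset_f.
  by move: hneg; rewrite positiveE hd HO dO.
case: existsP => [[h1 /existsP[h2 /and5P[S1 S2 /eqP w1 /eqP w2]]]|nex].
  case: (boolP (positive O h1)) => [_|n1 _]; last by rewrite (neg_M h1).
  by case: (boolP (positive O h2)) => // n2 _; rewrite (neg_M h2).
case: (boolP (d \in heads M)) => // /imsetP[h hM hd]; case: nex.
have hneg : ~~ positive O h by rewrite positiveE negbK -hd.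
have hM0 : h \notin M0 by apply: contra hneg => /M0_pos.
have wh : hwhite h = edge d by rewrite hd.
have [h0 h0M0 wh0] := matching_white_ex HM0 (edge d).
have h0M : h0 \notin M.
  apply: contraNN hM0 => h0M.
  by rewrite (matching_white_inj HM hM h0M) // wh.
exists h; apply/existsP; exists h0.
by rewrite !inE h0M0 h0M hM hM0 wh wh0 !eqxx (negPf hneg) (M0_pos h0M0).
Qed.

(** * The Kasteleyn matrix and its determinant *)

Definition is_matching (M : {set hedgeP G}) : bool :=
  [&& [forall h, (h \in M) ==> hvalid q qs h],
      [forall w, #|[set h in M | hwhite h == w]| == 1%N]
    & [forall b, is_black q qs b ==> (#|[set h in M | hblack h == b]| == 1%N)]].

Lemma is_matchingP M : reflect (matching M) (is_matching M).
Proof.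
apply: (iffP and3P) => -[vM wM bM]; split.
- by move=> h; apply/implyP; apply: (forallP vM).
- by move=> w; apply/eqP; apply: (forallP wM).
- by move=> b bb; apply/eqP; have /implyP := forallP bM b; apply.
- by apply/forallP=> h; apply/implyP; apply: vM.
- by apply/forallP=> w; apply/eqP.
by apply/forallP=> b; apply/implyP => /bM/eqP.
Qed.

Local Notation n := #|edg G|.

(** Euler's formula is what makes the Kasteleyn matrix square. *)
Lemma card_black : #|is_black (G := G) q qs| = n.
Proof.
have -> : #|is_black (G := G) q qs| = (#|predC1 q| + #|predC1 qs|)%N.
  rewrite -!sum1_card big_sumType /=.
  by congr (_ + _)%N; apply: eq_bigl => x; rewrite !inE.
have := map_euler; rewrite (cardD1 q) (cardD1 qs) !inE.
have -> : #|[predD1 vtx G & q]| = #|predC1 q| by apply: eq_card => x; rewrite !inE andbT.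
have -> : #|[predD1 fce G & qs]| = #|predC1 qs| by apply: eq_card => x; rewrite !inE andbT.
lia.
Qed.

Definition black_at (j : 'I_n) : black_t G :=
  enum_val (cast_ord (esym card_black) j).

Lemma black_at_black j : is_black q qs (black_at j).
Proof. exact: enum_valP. Qed.

Lemma black_at_inj : injective black_at.
Proof. by move=> i j /enum_val_inj/cast_ord_inj. Qed.

Lemma black_at_surj b : is_black q qs b -> exists j, black_at j = b.
Proof.
move=> bb; exists (cast_ord card_black (enum_rank_in bb b)).
by rewrite /black_at cast_ordK enum_rankK_in.
Qed.

Lemma sum_black (F : black_t G -> int) :
  \sum_(b | is_black q qs b) F b = \sum_j F (black_at j).
Proof.
rewrite (big_enum_val (A := is_black q qs)).
apply: reindex; apply: onW_bij.
by exists (cast_ord card_black); [exact: cast_ordKV | exact: cast_ordK].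
Qed.

Definition kasteleyn_mx : 'M[int]_n :=
  \matrix_(i, j) rvec q qs O (black_at j) (enum_val i).

Lemma kasteleyn_det_le : (`|\det kasteleyn_mx| <= #|[set M | is_matching M]|)%N.
Proof.
pose H (i j : 'I_n) := [set h : hedgeP G | (hwhite h == enum_val i) && (hblack h == black_at j)].
have leH i j : (`|kasteleyn_mx i j| <= #|H i j|)%N.
  by rewrite mxE rvec_norm_le // black_at_black.
apply: leq_trans (norm_det_le leH) _.
pose im (p : {perm 'I_n} * {ffun 'I_n -> hedgeP G}) := [set p.2 i | i in 'I_n].
(* The white endpoints recover [k] from its image; the black endpoints then recover [s]. *)
rewrite -(card_in_imset (f := im)) => [|[s k] [s' k']]; last first.
  rewrite !inE /= => /forallP kH /forallP k'H' eq_im.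
  have kk' i : k i = k' i.
    have : k i \in im (s', k') by rewrite -eq_im imset_f.
    case/imsetP=> i' _ /= ki.
    have := k'H' i'; have := kH i; rewrite !inE -ki => /andP[/eqP-> _] /andP[+ _].
    by move/eqP/enum_val_inj=> ii'; rewrite ki ii'.
  congr (_, _); last exact/ffunP.
  apply/permP=> i; apply: black_at_inj.
  have := k'H' i; have := kH i; rewrite !inE kk' => /andP[_ /eqP<-] /andP[_ /eqP<-].
  by [].
apply/subset_leq_card/subsetP => _ /imsetP[[s k] + ->]; rewrite !inE /= => /forallP kH.
have kw i : hwhite (k i) = enum_val i by have := kH i; rewrite inE => /andP[/eqP].
have kb i : hblack (k i) = black_at (s i) by have := kH i; rewrite inE => /andP[_ /eqP].
apply/is_matchingP; split.
- by move=> _ /imsetP[i _ ->]; rewrite /hvalid kb black_at_black.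
- move=> w; apply/eqP/cards1P; exists (k (enum_rank w)); apply/setP=> h; rewrite !inE.
  apply/andP/eqP => [[/imsetP[i _ ->] /eqP]|->].
    by rewrite kw /= => <-; rewrite enum_valK.
  by rewrite kw enum_rankK imset_f.
move=> b /black_at_surj[j <-]; apply/eqP/cards1P; exists (k (s^-1%g j)).
apply/setP=> h; rewrite !inE; apply/andP/eqP => [[/imsetP[i _ ->] /eqP]|->].
  by rewrite kb /= => /black_at_inj <-; rewrite permK.
by rewrite kb permKV imset_f.
Qed.

Lemma in_prin_potential x : in_prin q qs O x ->
  exists f g, [/\ f q = 0, g qs = 0 & forall d, d \in O ->
    x (edge d) = (f (vert (al d)) - f (vert d)) + (g (face (al d)) - g (face d))].
Proof.
case=> c xE; exists (potential c \o inl), (potential c \o inr).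
rewrite /= /potential /= !eqxx; split=> // d dO.
by rewrite xE prin_potential.
Qed.

Lemma psi_vec_inj M M' : matching M -> matching M' ->
  in_prin q qs O (psi_vec O M0 M - psi_vec O M0 M') -> M = M'.
Proof.
move=> HM HM' /in_prin_potential[f [g [fq gqs fgE]]]; apply: heads_inj => //.
(* Both sides change sign under [alpha], so the identity extends from [O] to all darts. *)
have fgEO d : f (vert (al d)) - f (vert d) + (g (face (al d)) - g (face d))
    = (d \in heads M)%:R - (d \in heads M')%:R.
  case: (boolP (d \in O)) => dO.
    by rewrite -fgE // [LHS]ffunE [X in _ + X]ffunE !psi_vecE.
  have adO : al d \in O by rewrite HO.
  have := fgE _ adO; rewrite [LHS]ffunE [X in _ + X]ffunE !psi_vecE // alK !heads_al //.
  by do 2!case: (_ \in heads _); rewrite /=; lia.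
apply/setP=> d; have [fd gd] := potential_eq0 HM HM' fq gqs fgEO d.
have [fad gad] := potential_eq0 HM HM' fq gqs fgEO (al d).
by move: (fgEO d); rewrite fd gd fad gad; do 2!case: (_ \in heads _).
Qed.

(** A kernel vector is a pair of potentials whose gradient and curl add up to 0: the case
    [M = M' = M0] of [potential_eq0]. *)
Lemma kasteleyn_ker (c : 'cV_n) : kasteleyn_mx *m c = 0 -> c = 0.
Proof.
move=> Ac0; pose c' b := \sum_(j | black_at j == b) c j 0.
have c'E j : c' (black_at j) = c j 0.
  by rewrite /c' (eq_bigl (pred1 j)) ?big_pred1_eq // => i; rewrite /= (inj_eq black_at_inj).
have fg0 d : d \in O -> (potential c' (inl (vert (al d))) - potential c' (inl (vert d)))
    + (potential c' (inr (face (al d))) - potential c' (inr (face d))) = 0.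
  move=> dO; rewrite -prin_potential // sum_black.
  have /matrixP/(_ (enum_rank (edge d)) 0) := Ac0; rewrite !mxE => Ac.
  rewrite -[RHS]Ac.
  by apply: eq_bigr => j _; rewrite mxE c'E enum_rankK mulrC.
have fgE d : (potential c' (inl (vert (al d))) - potential c' (inl (vert d)))
    + (potential c' (inr (face (al d))) - potential c' (inr (face d)))
    = (d \in heads M0)%:R - (d \in heads M0)%:R.
  rewrite subrr; case: (boolP (d \in O)) => [/fg0//|dO].
  by have := fg0 (al d); rewrite HO dO alK => /(_ isT); lia.
have potq : potential c' (inl q) = 0 by rewrite /potential /= eqxx.
have potqs : potential c' (inr qs) = 0 by rewrite /potential /= eqxx.
have pot0 := @potential_eq0 _ _ (fun v => potential c' (inl v))
  (fun f => potential c' (inr f)) HM0 HM0 potq potqs fgE.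
apply/matrixP=> j k; rewrite ord1 [RHS]mxE -c'E.
have bj := black_at_black j.
have -> : c' (black_at j) = potential c' (black_at j) by rewrite /potential bj.
(* The half-edge of [M0] at a black vertex supplies a dart there. *)
by have [[] d _ <-] := matching_black_ex HM0 bj; have [] := pot0 d.
Qed.

Lemma psi_vec_surj x : exists2 M, matching M & in_prin q qs O (x - psi_vec O M0 M).
Proof.
pose vec (y : {ffun edg G -> int}) : 'cV[int]_n := \col_i y (enum_val i).
have vecP y z : (exists c, vec y - vec z = kasteleyn_mx *m c) -> in_prin q qs O (y - z).
  case=> c yz; exists [ffun b => \sum_(j | black_at j == b) c j 0] => w.
  have /matrixP/(_ (enum_rank w) 0) := yz.
  rewrite !mxE enum_rankK => yzw.
  rewrite [LHS]ffunE [X in _ + X]ffunE yzw.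
  rewrite sum_black; apply: eq_bigr => j _; rewrite ffunE mxE enum_rankK mulrC.
  congr (_ * _); rewrite (eq_bigl (pred1 j)) ?big_pred1_eq // => i.
  by rewrite /= (inj_eq black_at_inj).
have [|M + xM] := lattice_transversal kasteleyn_ker kasteleyn_det_le
    (v := vec \o psi_vec O M0) _ (vec x).
  move=> M M'; rewrite !inE => /is_matchingP HM /is_matchingP HM' /vecP.
  exact: psi_vec_inj.
by rewrite inE => /is_matchingP HM; exists M => //; apply: vecP.
Qed.

End Orientation.
End PlaneMap.

Theorem theorem3p2 (G : cmap) (q : vtx G) (qs : fce G)
  (HG : plane_map G) (Hq : on_outer q qs)
  (M0 : {set hedgeP G}) (HM0 : perfect_matching q qs M0)
  (T0 : {set edg G}) (HT0 : spanning_tree T0) (HMT : M0 = temperley q qs T0) :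
  let O := orientT q qs T0 in
  (* Psi_{M0} is injective into K(G^+) = Z^W / Prin(G^+) *)
  (forall M M', perfect_matching q qs M -> perfect_matching q qs M' ->
      in_prin q qs O (psi_vec O M0 M - psi_vec O M0 M') -> M = M') /\
  (* Psi_{M0} is surjective onto K(G^+) *)
  (forall x : {ffun edg G -> int}, exists M, perfect_matching q qs M /\
      in_prin q qs O (x - psi_vec O M0 M)) /\
  (* Psi_{M0}(M0) = 0 in K(G^+) *)
  in_prin q qs O (psi_vec O M0 M0).
Proof.
move=> O.
(* Each edge is either in [T0] or not, so one of the two half-edges at every dart outside [O] is in
   [M0]. *)
have O_heads d : (d \in heads M0) = (d \notin O).
  by rewrite headsE HMT 2!in_set /= !positiveE /= -andb_orr orbN andbT.
have HO d : (alpha d \in O) = (d \notin O).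
  by rewrite -[LHS]negbK -O_heads (heads_al HG HM0) O_heads negbK.
have M0_pos : {in M0, forall h, positive O h}.
  by move=> h M0h; rewrite positiveE -O_heads imset_f.
split; [|split].
- by move=> M M' HM HM'; apply: (psi_vec_inj HG Hq HO HM0 M0_pos).
- move=> x; have [M HM xM] := psi_vec_surj HG Hq HO HM0 M0_pos x.
  by exists M.
exists 0 => w; rewrite big1 => [|b _]; last by rewrite ffunE mul0r.
rewrite ffunE setDv setU0; case: existsP => // -[h1 /existsP[h2]].
by rewrite inE.
Qed.
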